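(* Let $\Theta$ be a universal positive closed first-order formula in the language of groups. If a group $G$ has a finite normal subgroup $N$ such that $\Theta$ holds in the quotient group $G/N$, then $G$ has a characteristic finite subgroup $H$ such that $\Theta$ holds in $G/H$.
   Context: A universal positive closed formula is a sentence $\forall x_1\cdots\forall x_n\,\psi(x_1,\dots,x_n)$ where $\psi$ is built from group equations $u(x_1,\dots,x_n)=v(x_1,\dots,x_n)$ using only conjunctions and disjunctions (no negations), e.g. $\forall x\,(x^2=1\vee x^3=1)$. *)

(* Defs.v *)
From HB Require Import structures.
From mathcomp Require Import all_boot.
From mathcomp Require Import boolp classical_sets functions cardinality.

Set Implicit Arguments.
Unset Strict Implicit.
Unset Printing Implicit Defensive.

Local Open Scope group_scope.
Local Open Scope classical_set_scope.
Local Open Scope quotient_scope.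

(* [groupType] asks for a choice structure on the carrier but not for
   finiteness; in the presence of [boolp] every type has a choice structure,
   so [groupType] covers arbitrary groups. *)

Definition normal_subgroup (G : groupType) (N : set G) : Prop :=
  group_closed [in N] /\ forall x g : G, N x -> N (x ^ g).

Definition characteristic_subgroup (G : groupType) (H : set G) : Prop :=
  group_closed [in H] /\
  forall f : {multiplicative G -> G}, bijective f -> f @` H = H.

Section NormalSubgroupTheory.
Variables (G : groupType) (N : set G) (nN : normal_subgroup N).

Lemma nsg1 : N 1.
Proof. by case: nN => -[/set_mem]. Qed.

Lemma nsgV x : N x -> N x^-1.
Proof.
case: nN => gN _ Nx.
by apply/set_mem/(group_closedV gN)/mem_set.
Qed.

Lemma nsgM x y : N x -> N y -> N (x * y).
Proof.
case: nN => gN _ Nx Ny.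
by apply/set_mem/(group_closedM gN); apply/mem_set.
Qed.

Lemma nsgJ x g : N x -> N (x ^ g).
Proof. by case: nN => _; apply. Qed.

End NormalSubgroupTheory.

Lemma characteristic_normal (G : groupType) (H : set G) :
  characteristic_subgroup H -> normal_subgroup H.
Proof.
move=> [gH chH]; split=> // x g Hx.
have conjM : {morph conjg^~ g : a b / a * b}.
  by move=> a b /=; rewrite conjMg.
pose cM := isMultiplicative.Build G G (conjg^~ g) conjM.
pose c : {multiplicative G -> G} := HB.pack (conjg^~ g) cM.
have bijc : bijective c.
  by exists (conjg^~ g^-1) => a /=; rewrite /c /= -conjgM ?mulgV ?mulVg conjg1.
by rewrite -(chH c bijc); exists x.
Qed.

(* The relation x N = y N. *)
Definition coset_rel (G : groupType) (N : set G) : rel G :=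
  fun x y => `[< N (x^-1 * y) >].

Section Quotient.
Variables (G : groupType) (N : set G) (nN : normal_subgroup N).

Lemma coset_rel_refl : reflexive (coset_rel N).
Proof. by move=> x; apply/asboolP; rewrite mulVg; exact: (nsg1 nN). Qed.

Lemma coset_rel_sym : symmetric (coset_rel N).
Proof.
move=> x y; apply/asboolP/asboolP => /(nsgV nN); by rewrite invgM invgK.
Qed.

Lemma coset_rel_trans : transitive (coset_rel N).
Proof.
move=> y x z /asboolP xy /asboolP yz; apply/asboolP.
by move: (nsgM nN xy yz); rewrite mulgA mulgK.
Qed.

Canonical coset_equiv :=
  EquivRel (coset_rel N) coset_rel_refl coset_rel_sym coset_rel_trans.

Definition quotient_group := {eq_quot coset_equiv}.

HB.instance Definition _ := Choice.on quotient_group.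

Definition quotient_proj (x : G) : quotient_group := \pi_{eq_quot coset_equiv} x.

Local Notation p := quotient_proj.

Lemma quotient_proj_eqP x y : p x = p y <-> N (x^-1 * y).
Proof.
by split=> [/eqquotP/asboolP //|xy]; apply/eqquotP/asboolP.
Qed.

Lemma quotient_proj_surj (q : quotient_group) : exists x, q = p x.
Proof. by exists (repr q); rewrite /p reprK. Qed.

Lemma repr_proj x : N ((repr (p x))^-1 * x).
Proof. by apply/quotient_proj_eqP; rewrite /p reprK. Qed.

Definition quotient_one : quotient_group := p 1.
Definition quotient_mul (q r : quotient_group) : quotient_group :=
  p (repr q * repr r).
Definition quotient_inv (q : quotient_group) : quotient_group := p (repr q)^-1.

Lemma quotient_mulE x y : quotient_mul (p x) (p y) = p (x * y).
Proof.
apply/quotient_proj_eqP; set a := repr _; set b := repr _.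
have -> : (a * b)^-1 * (x * y) = (a^-1 * x) ^ b * (b^-1 * y).
  by rewrite invgM conjgE !mulgA mulgK.
by apply: (nsgM nN); [apply: (nsgJ nN)|]; exact: repr_proj.
Qed.

Lemma quotient_invE x : quotient_inv (p x) = p x^-1.
Proof.
apply/quotient_proj_eqP; set a := repr _; rewrite invgK.
have -> : a * x^-1 = (a^-1 * x)^-1 ^ a^-1.
  by rewrite conjgE invgK invgM invgK !mulgA mulgK.
by apply/(nsgJ nN)/(nsgV nN)/repr_proj.
Qed.

Lemma quotient_mulA : associative quotient_mul.
Proof.
move=> q r s.
have [x ->] := quotient_proj_surj q; have [y ->] := quotient_proj_surj r.
by have [z ->] := quotient_proj_surj s; rewrite !quotient_mulE mulgA.
Qed.

Lemma quotient_mul1g : left_id quotient_one quotient_mul.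
Proof.
by move=> q; have [x ->] := quotient_proj_surj q; rewrite quotient_mulE mul1g.
Qed.

Lemma quotient_mulg1 : right_id quotient_one quotient_mul.
Proof.
by move=> q; have [x ->] := quotient_proj_surj q; rewrite quotient_mulE mulg1.
Qed.

Lemma quotient_mulVg : left_inverse quotient_one quotient_inv quotient_mul.
Proof.
move=> q; have [x ->] := quotient_proj_surj q.
by rewrite quotient_invE quotient_mulE mulVg.
Qed.

Lemma quotient_mulgV : right_inverse quotient_one quotient_inv quotient_mul.
Proof.
move=> q; have [x ->] := quotient_proj_surj q.
by rewrite quotient_invE quotient_mulE mulgV.
Qed.

HB.instance Definition _ := isGroup.Build quotient_group
  quotient_mulA quotient_mul1g quotient_mulg1 quotient_mulVg quotient_mulgV.

Lemma quotient_projM : {morph p : x y / x * y}.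
Proof. by move=> x y; rewrite -quotient_mulE. Qed.

End Quotient.

Inductive group_term (n : nat) : Type :=
| TVar of 'I_n
| TOne
| TMul of group_term n & group_term n
| TInv of group_term n.
Arguments TOne {n}.

Inductive positive_formula (n : nat) : Type :=
| PEq of group_term n & group_term n
| PAnd of positive_formula n & positive_formula n
| POr of positive_formula n & positive_formula n.

(* The sentence "forall x_1 ... x_n, psi"; every variable of psi is an ['I_n],
   so the sentence is closed. *)
Record universal_positive_sentence := UniversalPositive {
  ups_arity : nat;
  ups_matrix : positive_formula ups_arity }.

Section Semantics.
Variable Q : groupType.

Fixpoint eval_term n (a : 'I_n -> Q) (t : group_term n) : Q :=
  match t with
  | TVar i => a i
  | TOne => 1
  | TMul u v => eval_term a u * eval_term a v
  | TInv u => (eval_term a u)^-1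
  end.

Fixpoint sat_formula n (a : 'I_n -> Q) (psi : positive_formula n) : Prop :=
  match psi with
  | PEq u v => eval_term a u = eval_term a v
  | PAnd f g => sat_formula a f /\ sat_formula a g
  | POr f g => sat_formula a f \/ sat_formula a g
  end.

Definition holds_in (Theta : universal_positive_sentence) : Prop :=
  forall a : 'I_(ups_arity Theta) -> Q, sat_formula a (ups_matrix Theta).

End Semantics.

(* Main.v *)
Require Import Defs.
From HB Require Import structures.
From mathcomp Require Import all_boot finmap.
From mathcomp Require Import boolp classical_sets functions cardinality.

(** Replace each equation u = v of the matrix by the condition u^-1 v \in N;
    the copies of N attached to the various equations may then be varied
    independently, one at a time. Suppose that the matrix holds everywhere with
    D attached to a chosen equation and M to the equations not yet treated, and
    take D minimal. Applying an automorphism f, the matrix also holds with the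
    preimages f^-1 D and f^-1 M, hence, by positivity, M and f^-1 M may both be
    enlarged to M f^-1 M. At a given assignment a monotone statement
    which is true for D and for f^-1 D is true for their intersection, so
    minimality forces D to be contained in f^-1 D for every f, that is, D is
    characteristic. When all equations have been treated, the product of the
    resulting characteristic subgroups is the required H. *)

Set Implicit Arguments.
Unset Strict Implicit.
Unset Printing Implicit Defensive.

Local Open Scope group_scope.
Local Open Scope classical_set_scope.

Lemma exists_minimal_finite_set (T : choiceType) (P : set T -> Prop)
    (A : set T) :
  finite_set A -> P A ->
  exists B, [/\ finite_set B, P B &
                forall C, C `<=` B -> P C -> B `<=` C].
Proof.
have [n] := ubnP #|` fset_set A|%fset.
elim: n A => // n IHn A; rewrite ltnS => leAn finA PA.
have [minA|] := pselect (forall C, C `<=` A -> P C -> A `<=` C).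
  by exists A.
move=> /existsNP[C /not_implyP[CA /not_implyP[PC nAC]]].
have finC := sub_finite_set CA finA.
apply: (IHn C) => //; apply: leq_trans leAn; apply: fproper_ltn_card.
by rewrite fproperE; apply/andP; split; [|apply/negP]; rewrite -fset_set_sub.
Qed.

(** * Finite normal subgroups and characteristic subgroups *)

Section FiniteNormalSubgroups.
Variable G : groupType.
Implicit Types (A B H M N : set G) (f : {multiplicative G -> G}).

Lemma normal_subgroupP N :
  N 1 -> (forall x y, N x -> N y -> N (x * y)) ->
  (forall x, N x -> N x^-1) -> (forall x g, N x -> N (x ^ g)) ->
  normal_subgroup N.
Proof.
move=> N1 NM NV NJ; split; last by move=> x g; exact: NJ.
split=> [|x y /set_mem Nx /set_mem Ny]; apply/mem_set => //.
by apply: NM => //; apply: NV.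
Qed.

Lemma normal_subgroupI A B :
  normal_subgroup A -> normal_subgroup B -> normal_subgroup (A `&` B).
Proof.
move=> nA nB; apply: normal_subgroupP.
- by split; [exact: (nsg1 nA)|exact: (nsg1 nB)].
- by move=> x y [Ax Bx] [Ay By]; split; [exact: (nsgM nA)|exact: (nsgM nB)].
- by move=> x [Ax Bx]; split; [exact: (nsgV nA)|exact: (nsgV nB)].
- by move=> x g [Ax Bx]; split; [exact: (nsgJ nA)|exact: (nsgJ nB)].
Qed.

(* [{multiplicative G -> G}] records only the product law, so the library's
   [gmulf1], [gmulfV] and [gmulfJ], stated for unital morphisms, do not apply. *)
Lemma multiplicative1 f : f 1 = 1.
Proof. by apply: (mulgI (f 1)); rewrite -gmulfM !mulg1. Qed.

Lemma multiplicativeV f : {morph f : x / x^-1}.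
Proof.
by move=> x; apply: (mulgI (f x)); rewrite -gmulfM !mulgV multiplicative1.
Qed.

Lemma multiplicativeJ f : {morph f : x y / x ^ y}.
Proof. by move=> x y; rewrite !conjgE !gmulfM multiplicativeV. Qed.

Lemma normal_subgroup_preimage f N :
  normal_subgroup N -> normal_subgroup (f @^-1` N).
Proof.
move=> nN; apply: normal_subgroupP => /=.
- by rewrite multiplicative1; exact: (nsg1 nN).
- by move=> x y Nx Ny; rewrite gmulfM; exact: (nsgM nN).
- by move=> x Nx; rewrite multiplicativeV; exact: (nsgV nN).
- by move=> x g Nx; rewrite multiplicativeJ; exact: (nsgJ nN).
Qed.

Definition mulset A B : set G := [set x * y | x in A & y in B].

Lemma normal_subgroupM A B :
  normal_subgroup A -> normal_subgroup B -> normal_subgroup (mulset A B).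
Proof.
move=> nA nB; apply: normal_subgroupP.
- exists 1; first exact: (nsg1 nA).
  by exists 1; [exact: (nsg1 nB)|rewrite mulg1].
- move=> _ _ [x Ax [y By <-]] [x' Ax' [y' By' <-]].
  (* Moving [x'] to the left past [y] turns it into its conjugate by [y^-1], which stays in [A]. *)
  exists (x * x' ^ y^-1); first by apply: (nsgM nA) => //; exact: (nsgJ nA).
  exists (y * y'); first exact: (nsgM nB).
  by rewrite conjgE invgK !mulgA mulgVK.
- move=> _ [x Ax [y By <-]].
  exists (x^-1 ^ y); first by apply: (nsgJ nA); exact: (nsgV nA).
  exists y^-1; first exact: (nsgV nB).
  by rewrite conjgE invgM !mulgA mulgK.
- move=> _ g [x Ax [y By <-]].
  exists (x ^ g); first exact: (nsgJ nA).
  by exists (y ^ g); [exact: (nsgJ nB)|rewrite conjMg].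
Qed.

Lemma sub_mulsetl A B : normal_subgroup B -> A `<=` mulset A B.
Proof.
by move=> nB x Ax; exists x => //; exists 1; [exact: (nsg1 nB)|rewrite mulg1].
Qed.

Lemma sub_mulsetr A B : normal_subgroup A -> B `<=` mulset A B.
Proof.
by move=> nA x Bx; exists 1; [exact: (nsg1 nA)|exists x => //; rewrite mul1g].
Qed.

Definition finite_normal N := finite_set N /\ normal_subgroup N.

Lemma finite_normalI A B :
  finite_normal A -> finite_normal B -> finite_normal (A `&` B).
Proof.
by move=> [finA nA] [_ nB]; split; [exact: finite_setIl|exact: normal_subgroupI].
Qed.

Lemma finite_normalM A B :
  finite_normal A -> finite_normal B -> finite_normal (mulset A B).
Proof.
move=> [finA nA] [finB nB].
by split; [exact: finite_image2|exact: normal_subgroupM].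
Qed.

Lemma finite_normal_preimage f N :
  bijective f -> finite_normal N -> finite_normal (f @^-1` N).
Proof.
move=> bijf [finN nN]; split; last exact: normal_subgroup_preimage.
by apply: finite_preimage => // x y _ _; exact: bij_inj.
Qed.

(** Applying the inclusion to the inverse automorphism yields the reverse inclusion. *)
Lemma characteristic_subgroupP H :
  characteristic_subgroup H <->
  group_closed [in H] /\ forall f, bijective f -> H `<=` f @^-1` H.
Proof.
split=> -[gH chH]; split=> // f bijf.
  by move=> x Hx /=; rewrite -(chH f bijf); exists x.
have [g fK gK] := bijf.
pose gM := isMultiplicative.Build G G g (can2_gmulfM fK gK).
pose g' : {multiplicative G -> G} := HB.pack g gM.
apply/seteqP; split=> [_ [x Hx <-]|y Hy]; first exact: (chH f bijf).
exists (g y); last exact: gK.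
by apply: (chH g') => //; exists f.
Qed.

Lemma characteristic_preimage f H :
  characteristic_subgroup H -> bijective f -> f @^-1` H = H.
Proof.
move=> chH bijf; apply/seteqP; split; last first.
  by move/characteristic_subgroupP: chH => [_]; apply.
move=> x /= Hfx; case: chH => _ /(_ f bijf) fH.
by move: Hfx; rewrite -{1}fH => -[y Hy] /(bij_inj bijf) <-.
Qed.

Lemma characteristic_subgroupM A B :
  characteristic_subgroup A -> characteristic_subgroup B ->
  characteristic_subgroup (mulset A B).
Proof.
move=> chA chB; apply/characteristic_subgroupP; split.
  by case: (normal_subgroupM (characteristic_normal chA)
                             (characteristic_normal chB)).
move=> f bijf _ [x Ax [y By <-]] /=; rewrite gmulfM.
exists (f x); first by rewrite -(characteristic_preimage chA bijf) in Ax.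
by exists (f y) => //; rewrite -(characteristic_preimage chB bijf) in By.
Qed.

(** * Truth of a positive formula modulo a normal subgroup *)

Section Formulas.
Variable n : nat.
Implicit Types (a : 'I_n -> G) (t : group_term n) (psi : positive_formula n).

(** Truth in G/N pulled back to G: as assignments stay in G, [N] can vary without changing any
    type. *)
Fixpoint sat_mod N a psi : Prop :=
  match psi with
  | PEq u v => N ((eval_term a u)^-1 * eval_term a v)
  | PAnd f g => sat_mod N a f /\ sat_mod N a g
  | POr f g => sat_mod N a f \/ sat_mod N a g
  end.

Lemma eval_term_morph f a t : eval_term (f \o a) t = f (eval_term a t).
Proof.
by elim: t => [i||u IHu v IHv|u IHu] //=;
  rewrite ?multiplicative1 ?IHu ?IHv ?gmulfM ?multiplicativeV.
Qed.

Lemma sat_mod_preimage f N a psi :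
  sat_mod N (f \o a) psi <-> sat_mod (f @^-1` N) a psi.
Proof.
elim: psi => [u v|p IHp q IHq|p IHp q IHq] /=; rewrite ?IHp ?IHq //.
by rewrite !eval_term_morph gmulfM multiplicativeV.
Qed.

Lemma sat_mod_sub M N a psi : N `<=` M -> sat_mod N a psi -> sat_mod M a psi.
Proof.
move=> NM; elim: psi => [u v|p IHp q IHq|p IHp q IHq] /=; first exact: NM.
  by move=> [/IHp ? /IHq].
by move=> [/IHp|/IHq]; [left|right].
Qed.

Lemma eval_term_proj N (nN : normal_subgroup N) a t :
  eval_term (quotient_proj nN \o a) t = quotient_proj nN (eval_term a t).
Proof.
elim: t => [i||u IHu v IHv|u IHu] //=.
  by rewrite IHu IHv quotient_projM.
by rewrite IHu; exact: quotient_invE.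
Qed.

Lemma sat_formula_proj N (nN : normal_subgroup N) a psi :
  sat_formula (quotient_proj nN \o a) psi <-> sat_mod N a psi.
Proof.
elim: psi => [u v|p IHp q IHq|p IHp q IHq] /=; rewrite ?IHp ?IHq //.
by rewrite !eval_term_proj quotient_proj_eqP.
Qed.

Lemma sat_formula_quotient N (nN : normal_subgroup N) psi :
  (forall a : 'I_n -> quotient_group nN, sat_formula a psi) <->
  (forall a, sat_mod N a psi).
Proof.
split=> sat a; first exact/(sat_formula_proj nN).
have [b ->] : exists b : 'I_n -> G, a = quotient_proj nN \o b.
  exists (fun i => sval (cid (quotient_proj_surj (a i)))).
  by apply/funext => i /=; case: cid.
exact/sat_formula_proj.
Qed.

(** * Making the subgroups characteristic, one equation at a time *)

(* [K N a P] is the truth at [a] of a formula with a hole: [P] is the truth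
   value of the subformula in the hole, and [N] is the subgroup attached to the
   equations outside the hole that have not been treated yet. *)
Record positive_context (K : set G -> ('I_n -> G) -> Prop -> Prop) := {
  context_mono : forall M N a (P Q : Prop),
    N `<=` M -> (P -> Q) -> K N a P -> K M a Q;
  context_preimage : forall f N a P, bijective f ->
    K N (f \o a) P -> K (f @^-1` N) a P }.

(** Quantifying over all contexts lets an induction on the formula absorb the sibling subformula
    into the context. *)
Definition characteristic_in_hole (F : set G -> ('I_n -> G) -> Prop) :=
  forall K N, positive_context K -> finite_normal N ->
  (forall a, K N a (F N a)) ->
  exists H M, [/\ characteristic_subgroup H, finite_set H, finite_normal M &
                  forall a, K M a (F H a)].

Lemma characteristic_in_hole_eq (u v : group_term n) :
  characteristic_in_hole (fun N a => sat_mod N a (PEq u v)).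
Proof.
move=> K N cK fnN KN; pose w a := (eval_term a u)^-1 * eval_term a v.
(* [M] is existential so that it may grow while [D] shrinks. *)
pose good D := normal_subgroup D /\
  exists2 M, finite_normal M & forall a, K M a (D (w a)).
have goodN : good N by split; [case: fnN|exists N].
have [D [finD [nD [M fnM KM]] minD]] :=
  exists_minimal_finite_set (proj1 fnN) goodN.
exists D, M; split=> //; apply/characteristic_subgroupP.
split=> [|f bijf]; first by case: nD.
suff /(minD _ (@subIsetl _ _ _)) DI : good (D `&` f @^-1` D).
  exact: subset_trans DI (@subIsetr _ _ _).
have fnfM := finite_normal_preimage bijf fnM.
split; first exact/normal_subgroupI/normal_subgroup_preimage.
exists (mulset M (f @^-1` M)); first exact: finite_normalM.
(* If [w a] lies in [D], it lies in the intersection as soon as it lies in f^-1 D, so the statement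
   transported by [f] suffices. Otherwise the hole is false at [a] for [D], and monotonicity allows
   any proposition there. *)
move=> a; have [Dw|nDw] := pselect (D (w a)).
  have := context_preimage cK bijf (KM (f \o a)).
  apply: (context_mono cK); first exact: sub_mulsetr (proj2 fnM).
  by rewrite /w !eval_term_morph -multiplicativeV -gmulfM.
by apply: (context_mono cK) (KM a) => //; exact: sub_mulsetl (proj2 fnfM).
Qed.

Lemma characteristic_in_hole_op (op : Prop -> Prop -> Prop) p q :
  (forall P P' Q Q' : Prop, (P -> P') -> (Q -> Q') -> op P Q -> op P' Q') ->
  characteristic_in_hole (fun N a => sat_mod N a p) ->
  characteristic_in_hole (fun N a => sat_mod N a q) ->
  characteristic_in_hole (fun N a => op (sat_mod N a p) (sat_mod N a q)).
Proof.
move=> opS IHp IHq K N cK fnN KN.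
(* [q] is still untreated, so its subgroup varies with [M]. *)
pose Kp M a P := K M a (op P (sat_mod M a q)).
have cKp : positive_context Kp.
  split=> [M' N' a P Q NM PQ|f N' a P bijf].
    by apply: (context_mono cK) => //; apply: opS => //; exact: sat_mod_sub.
  move=> /(context_preimage cK bijf); apply: (context_mono cK) => //.
  by apply: opS => // /sat_mod_preimage.
have [H1 [M1 [chH1 finH1 fnM1 KM1]]] := IHp Kp N cKp fnN KN.
(* [p] now keeps the fixed subgroup [H1]; the context commutes with preimages because [H1] is
   characteristic. *)
pose Kq M a P := K M a (op (sat_mod H1 a p) P).
have cKq : positive_context Kq.
  split=> [M' N' a P Q NM PQ|f N' a P bijf].
    by apply: (context_mono cK) => //; exact: opS.
  move=> /(context_preimage cK bijf); apply: (context_mono cK) => //.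
  apply: opS => //; rewrite -{2}(characteristic_preimage chH1 bijf).
  by move/sat_mod_preimage.
have [H2 [M2 [chH2 finH2 fnM2 KM2]]] := IHq Kq M1 cKq fnM1 KM1.
exists (mulset H1 H2), M2; split=> //.
- exact: characteristic_subgroupM.
- exact: finite_image2.
- move=> a; apply: (context_mono cK) (KM2 a) => //; apply: opS.
    by apply: sat_mod_sub; exact: sub_mulsetl (characteristic_normal chH2).
  by apply: sat_mod_sub; exact: sub_mulsetr (characteristic_normal chH1).
Qed.

Lemma characteristic_in_hole_sat psi :
  characteristic_in_hole (fun N a => sat_mod N a psi).
Proof.
elim: psi => [u v|p IHp q IHq|p IHp q IHq].
- exact: characteristic_in_hole_eq.
- by apply: (characteristic_in_hole_op (op := and)) => // P P' Q Q' ? ? [? ?];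
    split; auto.
- by apply: (characteristic_in_hole_op (op := or)) => // P P' Q Q' ? ? [?|?];
    [left|right]; auto.
Qed.

End Formulas.
End FiniteNormalSubgroups.

Theorem mainTheorem4 (Theta : universal_positive_sentence) (G : groupType) :
  (exists (N : set G) (nN : normal_subgroup N),
      finite_set N /\ holds_in (quotient_group nN) Theta) ->
  exists (H : set G) (charH : characteristic_subgroup H),
      finite_set H /\
      holds_in (quotient_group (characteristic_normal charH)) Theta.
Proof.
move=> [N [nN [finN /sat_formula_quotient satN]]].
(* The whole matrix fills the hole, so no equation is left outside and the enlarged subgroup can be
   discarded. *)
have ctx_id : positive_context (
    fun (_ : set G) (_ : 'I_(ups_arity Theta) -> G) P => P).
  by split=> // M N' a P Q _; apply.
have [H [_ [chH finH _ satH]]] :=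
  characteristic_in_hole_sat ctx_id (conj finN nN) satN.
by exists H, chH; split=> //; apply/sat_formula_quotient.
Qed.
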